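(* Let $M \ge L$, let $\mathbf{x},\mathbf{z}\in\mathbb{R}^d$, let $\mathbf{T}=\mathbf{T}_M(\mathbf{x},\mathbf{z})$ be one lazy cubic step and let $r=\|\mathbf{T}-\mathbf{x}\|$. Then $$f(\mathbf{x})-f(\mathbf{T})\;\ge\;\max\Bigl\{\frac{1}{648M^2}\,\xi(\mathbf{T})^3,\ \frac{1}{72\sqrt{2M}}\,\|\nabla f(\mathbf{T})\|_*^{3/2}\Bigr\}+\frac{M}{48}r^3-\frac{11L^3}{M^2}\|\mathbf{z}-\mathbf{x}\|^3 .$$
   Context: $\mathbf{B}\in\mathbb{R}^{d\times d}$ is a fixed symmetric positive definite matrix, $\|\mathbf{x}\|=\langle \mathbf{B}\mathbf{x},\mathbf{x}\rangle^{1/2}$ for $\mathbf{x}\in\mathbb{R}^d$, $\|\mathbf{g}\|_*=\langle \mathbf{g},\mathbf{B}^{-1}\mathbf{g}\rangle^{1/2}$ for gradients, and $\|\mathbf{A}\|=\sup_{\|\mathbf{x}\|\le1}\|\mathbf{A}\mathbf{x}\|_*$ for matrices $\mathbf{A}\in\mathbb{R}^{d\times d}$. The function $f:\mathbb{R}^d\to\mathbb{R}$ (not necessarily convex) is twice continuously differentiable and its Hessian is Lipschitz with constant $L>0$: $\|\nabla^2 f(\mathbf{x})-\nabla^2 f(\mathbf{y})\|\le L\|\mathbf{x}-\mathbf{y}\|$ for all $\mathbf{x},\mathbf{y}$. For $M>0$, a lazy cubic step $\mathbf{T}_M(\mathbf{x},\mathbf{z})$ denotes a global minimizer over $\mathbf{y}\in\mathbb{R}^d$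 of $$\langle\nabla f(\mathbf{x}),\mathbf{y}-\mathbf{x}\rangle+\tfrac12\langle\nabla^2 f(\mathbf{z})(\mathbf{y}-\mathbf{x}),\mathbf{y}-\mathbf{x}\rangle+\tfrac M6\|\mathbf{y}-\mathbf{x}\|^3 .$$ For $\mathbf{y}\in\mathbb{R}^d$, $\xi(\mathbf{y})=\bigl[-\lambda_{\min}(\mathbf{B}^{-1/2}\nabla^2 f(\mathbf{y})\mathbf{B}^{-1/2})\bigr]_+$, where $[t]_+=\max\{t,0\}$ and $\lambda_{\min}$ is the smallest eigenvalue. *)

(* Defs.v *)
From mathcomp Require Import all_boot all_order all_algebra.
From mathcomp Require Import all_classical all_reals all_analysis.

Set Implicit Arguments.
Unset Strict Implicit.
Unset Printing Implicit Defensive.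

Import Order.TTheory GRing.Theory Num.Theory.
Import numFieldNormedType.Exports.

Local Open Scope classical_set_scope.
Local Open Scope ring_scope.

Section LinearAlgebra.
Context {R : realType} {d : nat}.
Implicit Types (A B S : 'M[R]_d) (u v x g : 'cV[R]_d).

Definition dotv u v : R := (u^T *m v) 0 0.

Definition sym_posdef A : Prop :=
  A^T = A /\ forall x, x != 0 -> 0 < dotv (A *m x) x.

Definition primal_norm B x : R := Num.sqrt (dotv (B *m x) x).

Definition dual_norm B g : R := Num.sqrt (dotv g (invmx B *m g)).

Definition op_norm B A : R :=
  sup [set dual_norm B (A *m x) | x in [set x | primal_norm B x <= 1]].

(* The symmetric positive definite square root, which exists and is unique
   when A is itself symmetric positive definite; the default value 0 is only
   taken for other matrices. *)
Definition sqrt_mx A : 'M[R]_d :=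
  xget 0 [set S | sym_posdef S /\ S *m S = A].

(* The set of eigenvalues is finite, and it is nonempty when A is symmetric
   and d > 0, in which case the infimum is the least eigenvalue. *)
Definition lambda_min A : R := inf [set a | eigenvalue A a].

End LinearAlgebra.

Section Calculus.
Context {R : realType} {d : nat}.
Implicit Types (f : 'cV[R]_d -> R) (x z T : 'cV[R]_d) (B : 'M[R]_d).

Definition partial (i : 'I_d) f x : R := 'D_(delta_mx i 0 : 'cV[R]_d) f x.

Definition gradient f x : 'cV[R]_d := \col_i partial i f x.

Definition hessian f x : 'M[R]_d :=
  \matrix_(i, j) partial j (partial i f) x.

Definition twice_continuously_differentiable f : Prop :=
  [/\ forall x, differentiable f x,
      forall x, differentiable (gradient f) x
    & continuous (hessian f)].

Definition hessian_lipschitz B f (L : R) : Prop :=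
  forall x y, op_norm B (hessian f x - hessian f y) <= L * primal_norm B (x - y).

Definition lazy_cubic_model B f (M : R) x z (y : 'cV[R]_d) : R :=
  dotv (gradient f x) (y - x)
  + 2^-1 * dotv (hessian f z *m (y - x)) (y - x)
  + M / 6 * primal_norm B (y - x) ^+ 3.

(* T is one of the possible values of T_M(x, z): the global minimizer of the
   model need not be unique. *)
Definition is_lazy_cubic_step B f (M : R) x z T : Prop :=
  forall y, lazy_cubic_model B f M x z T <= lazy_cubic_model B f M x z y.

Definition xi B f x : R :=
  let S := sqrt_mx (invmx B) in
  Num.max (- lambda_min (S *m hessian f x *m S)) 0.

End Calculus.

(* Main.v *)
Require Import Defs.
From mathcomp Require Import all_boot all_order all_algebra.
From mathcomp Require Import all_classical all_reals all_analysis.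
From mathcomp Require Import ring lra.

Import Order.TTheory GRing.Theory Num.Theory.
Import numFieldNormedType.Exports.

Local Open Scope ring_scope.

(* Write h = T - x, r = |h|, s = |z - x|, H = Hess f(z).  Perturbing the global
   minimizer h of the cubic model gives stationarity,
     grad f(x) + H h + (M r / 2) B h = 0,
   and the global second-order condition H + (M r / 2) B >= 0.  Together with
   Taylor bounds for a Lipschitz Hessian they yield
     f(x) - f(T) >= (M/4 - L/6) r^3 - (L/2) s r^2,
     |grad f(T)|_* <= (L + M)/2 r^2 + L s r,
     xi(T) <= (M/2) r + L (r + s),
   and the claim is then an inequality between nonnegative reals, homogeneous
   of degree 3 in r and t = L s / M. *)

(** * Dot product, primal and dual norms *)

Section Dot.
Context {R : realType} {d : nat}.
Implicit Types (A B : 'M[R]_d) (u v w x g : 'cV[R]_d).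

Lemma dotvE u v : dotv u v = \sum_i u i 0 * v i 0.
Proof. by rewrite /dotv mxE; apply: eq_bigr => i _; rewrite mxE. Qed.

Lemma dotvC u v : dotv u v = dotv v u.
Proof. by rewrite !dotvE; apply: eq_bigr => i _; rewrite mulrC. Qed.

Lemma dotvDl u v w : dotv (u + v) w = dotv u w + dotv v w.
Proof. by rewrite /dotv linearD mulmxDl mxE. Qed.

Lemma dotvDr u v w : dotv u (v + w) = dotv u v + dotv u w.
Proof. by rewrite /dotv mulmxDr mxE. Qed.

Lemma dotvZl a u v : dotv (a *: u) v = a * dotv u v.
Proof. by rewrite /dotv linearZ -scalemxAl mxE. Qed.

Lemma dotvZr a u v : dotv u (a *: v) = a * dotv u v.
Proof. by rewrite /dotv -scalemxAr mxE. Qed.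

Lemma dotvNl u v : dotv (- u) v = - dotv u v.
Proof. by rewrite -scaleN1r dotvZl mulN1r. Qed.

Lemma dotvNr u v : dotv u (- v) = - dotv u v.
Proof. by rewrite -scaleN1r dotvZr mulN1r. Qed.

Lemma dotv0l u : dotv 0 u = 0.
Proof. by rewrite -(scale0r u) dotvZl mul0r. Qed.

Lemma dotv_mulmx A u v : dotv (A *m u) v = dotv u (A^T *m v).
Proof. by rewrite /dotv trmx_mul mulmxA. Qed.

Definition dotv_lin := (mulmxDr, mulmxDl, mulmxBr, mulmxBl, mulmxN, mulNmx,
  dotvDl, dotvDr, dotvNl, dotvNr, dotvZl, dotvZr).

End Dot.

Section Norms.
Context {R : realType} {d : nat} {B : 'M[R]_d}.
Hypothesis B_spd : sym_posdef B.
Implicit Types (A : 'M[R]_d) (u v w x y g : 'cV[R]_d).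
Local Notation "`| x |_B" := (primal_norm B x) (format "`| x |_B").

Lemma dotv_sym A u v : A^T = A -> dotv (A *m u) v = dotv (A *m v) u.
Proof. by move=> AT; rewrite dotv_mulmx AT dotvC. Qed.

Lemma dotvB_ge0 x : 0 <= dotv (B *m x) x.
Proof.
have [->|x0] := eqVneq x 0; first by rewrite mulmx0 dotv0l.
exact/ltW/B_spd.2.
Qed.

Lemma primal_norm_ge0 x : 0 <= `|x|_B.
Proof. exact: sqrtr_ge0. Qed.

Lemma primal_norm_sq x : `|x|_B ^+ 2 = dotv (B *m x) x.
Proof. by rewrite sqr_sqrtr// dotvB_ge0. Qed.

Lemma primal_norm_eq0 x : `|x|_B = 0 -> x = 0.
Proof.
move=> x0; apply/eqP/negPn/negP => /(B_spd.2).
by rewrite -primal_norm_sq x0 expr0n ltxx.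
Qed.

Lemma primal_normZ a x : `|a *: x|_B = `|a| * `|x|_B.
Proof.
rewrite /primal_norm -scalemxAr dotvZl dotvZr mulrA -expr2.
by rewrite sqrtrM ?sqr_ge0// sqrtr_sqr.
Qed.

Lemma primal_normN x : `|- x|_B = `|x|_B.
Proof. by rewrite -scaleN1r primal_normZ normrN1 mul1r. Qed.

Lemma primal_norm0 : `|0|_B = 0.
Proof. by rewrite -(scale0r 0) primal_normZ normr0 mul0r. Qed.

Lemma cauchy_schwarz x y : dotv (B *m x) y <= `|x|_B * `|y|_B.
Proof.
have [/primal_norm_eq0 ->|x0] := eqVneq `|x|_B 0.
  by rewrite mulmx0 dotv0l primal_norm0 mul0r.
have [/primal_norm_eq0 ->|y0] := eqVneq `|y|_B 0.
  by rewrite dotvC dotv0l primal_norm0 mulr0.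
have xy : 0 < `|x|_B * `|y|_B by rewrite mulr_gt0// lt_def ?x0 ?y0 primal_norm_ge0.
(* The squared norm of this vector is 2|x||y| (|x||y| - <Bx, y>), and its first factor is
   positive. *)
have := dotvB_ge0 (`|y|_B *: x - `|x|_B *: y).
rewrite !dotv_lin -!scalemxAr !dotv_lin -!primal_norm_sq (dotv_sym B y x) ?B_spd.1//.
set c := dotv _ _ => h; rewrite -(ler_pM2l xy); nra.
Qed.

Lemma ler_primal_normD x y : `|x + y|_B <= `|x|_B + `|y|_B.
Proof.
rewrite -(@ler_pXn2r _ 2)// ?nnegrE ?addr_ge0 ?primal_norm_ge0//.
rewrite primal_norm_sq !dotv_lin -!primal_norm_sq (dotv_sym B y x) ?B_spd.1//.
have := cauchy_schwarz x y; nra.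
Qed.

Lemma ler_dist_primal_norm x y : `| `|x|_B - `|y|_B | <= `|x - y|_B.
Proof.
have h u v : `|u|_B - `|v|_B <= `|u - v|_B.
  by have := ler_primal_normD (u - v) v; rewrite subrK; lra.
have := h y x; rewrite -(primal_normN (y - x)) opprB => hyx.
by rewrite ler_norml h andbT; lra.
Qed.

Lemma spd_unitmx : B \in unitmx.
Proof.
rewrite -row_free_unit; apply/inj_row_free => v vB.
apply/eqP/negPn/negP => v0.
have := B_spd.2 v^T; rewrite -(inj_eq trmx_inj) trmx0 trmxK => /(_ v0).
by rewrite -{1}B_spd.1 -trmx_mul vB trmx0 dotv0l ltxx.
Qed.

(** [invmx B *m g] is the Riesz representative of [g] for the inner product of [B], so the dual norm
    inherits the norm properties of the primal one. *)
Lemma dual_normE g : dual_norm B g = `|invmx B *m g|_B.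
Proof.
by rewrite /dual_norm /primal_norm mulmxA mulmxV ?spd_unitmx// mul1mx.
Qed.

Lemma dual_norm_ge0 g : 0 <= dual_norm B g.
Proof. exact: sqrtr_ge0. Qed.

Lemma dual_normZ a g : dual_norm B (a *: g) = `|a| * dual_norm B g.
Proof. by rewrite !dual_normE -scalemxAr primal_normZ. Qed.

Lemma dual_norm0 : dual_norm B 0 = 0.
Proof. by rewrite dual_normE mulmx0 primal_norm0. Qed.

Lemma ler_dual_normD g h : dual_norm B (g + h) <= dual_norm B g + dual_norm B h.
Proof. by rewrite !dual_normE mulmxDr ler_primal_normD. Qed.

Lemma dotv_dual_le g x : `|dotv g x| <= dual_norm B g * `|x|_B.
Proof.
have h u : dotv g u <= dual_norm B g * `|u|_B.
  have := cauchy_schwarz (invmx B *m g) u.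
  by rewrite mulmxA mulmxV ?spd_unitmx// mul1mx -dual_normE.
have := h (- x); rewrite dotvNr primal_normN => hNx.
by rewrite ler_norml h andbT; lra.
Qed.

Lemma dual_norm_le g c :
  0 <= c -> (forall w, dotv g w <= c * `|w|_B) -> dual_norm B g <= c.
Proof.
move=> c0 gc; have := gc (invmx B *m g); rewrite -dual_normE.
have -> : dotv g (invmx B *m g) = dual_norm B g ^+ 2.
  by rewrite dual_normE primal_norm_sq mulmxA mulmxV ?spd_unitmx// mul1mx.
rewrite expr2; have [->//|g0] := eqVneq (dual_norm B g) 0.
by rewrite ler_pM2r// lt_def g0 dual_norm_ge0.
Qed.

Lemma dual_norm_sum (I : Type) (r : seq I) (F : I -> 'cV[R]_d) :
  dual_norm B (\sum_(i <- r) F i) <= \sum_(i <- r) dual_norm B (F i).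
Proof.
elim/big_rec2: _ => [|i a g _ IH]; first by rewrite dual_norm0.
by rewrite (le_trans (ler_dual_normD _ _))// lerD2l.
Qed.

Lemma dual_norm_mulmx_le A x : dual_norm B (A *m x) <= op_norm B A * `|x|_B.
Proof.
have [x0|x0] := eqVneq `|x|_B 0.
  by rewrite (primal_norm_eq0 x x0) mulmx0 dual_norm0 primal_norm0 mulr0.
have xgt0 : 0 < `|x|_B by rewrite lt_def x0 primal_norm_ge0.
have xV : `| `|x|_B^-1 | = `|x|_B^-1 by rewrite ger0_norm// invr_ge0 ltW.
rewrite -ler_pdivrMr// mulrC -[X in X * _]xV -dual_normZ scalemxAr.
apply: ub_le_sup; last first.
  by exists (`|x|_B^-1 *: x) => //=; rewrite primal_normZ xV mulVf.
(* [ub_le_sup] needs a bounded set: on the unit ball each coordinate is at most the dual norm of its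
   basis vector in absolute value. *)
exists (\sum_i dual_norm B (delta_mx i 0 : 'cV_d) * dual_norm B (A *m (delta_mx i 0 : 'cV_d))).
move=> _ [y /= y1 <-].
rewrite [in leLHS](matrix_sum_delta y) mulmx_sumr.
rewrite (le_trans (dual_norm_sum _ _ _ ))//; apply: ler_sum => i _.
rewrite big_ord1 -scalemxAr dual_normZ ler_wpM2r ?dual_norm_ge0//.
have -> : y i 0 = dotv (delta_mx i 0) y.
  rewrite dotvE (bigD1 i) //= big1 ?addr0; first by rewrite mxE !eqxx mul1r.
  by move=> k /negPf kNi; rewrite mxE kNi mul0r.
by rewrite (le_trans (dotv_dual_le _ _))// ler_piMr// dual_norm_ge0.
Qed.

Lemma dotv_mulmx_le A x y :
  `|dotv (A *m x) y| <= op_norm B A * `|x|_B * `|y|_B.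
Proof.
rewrite (le_trans (dotv_dual_le _ _))// ler_wpM2r ?primal_norm_ge0//.
exact: dual_norm_mulmx_le.
Qed.

End Norms.

(** * Taylor bounds for a Lipschitz Hessian *)

(** Mean value theorem instead of integration: [c * t ^+ n.+1] has the error bound as its
    derivative, so subtracting it and the quadratic approximation leaves a function [g] with
    nonpositive derivative on [0, 1]. The signs [s = 1] and [s = -1] give the two halves of the
    absolute value. *)
Lemma taylor_increment_le {R : realType} (phi dphi : R -> R) (a b c : R) (n : nat) :
    (forall t, is_derive t (1 : R) phi (dphi t)) ->
    (forall t, 0 <= t <= 1 -> `|dphi t - (a + t * b)| <= c * (n.+1%:R * t ^+ n)) ->
  `|phi 1 - phi 0 - (a + 2^-1 * b)| <= c.
Proof.
move=> dphiE dphi_le.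
have key s : s ^+ 2 = 1 -> s * (phi 1 - phi 0 - (a + 2^-1 * b)) <= c.
  move=> s2; pose g (t : R) := s * phi t - s * a * t - s * 2^-1 * b * t ^+ 2 - c * t ^+ n.+1.
  have dg t : is_derive t (1 : R) g (s * (dphi t - (a + t * b)) - c * (n.+1%:R * t ^+ n)).
    have id' := is_derive_id t (1 : R).
    have := is_deriveB (is_deriveB (is_deriveB (is_deriveZ s (dphiE t))
      (is_deriveZ (s * a) id')) (is_deriveZ (s * 2^-1 * b) (is_deriveX 2 id')))
      (is_deriveZ c (is_deriveX n.+1 id')).
    rewrite !exprfctE => dF; apply: (is_derive_eq dF).
    by rewrite /GRing.scale /= !mulr1 expr1; field.
  have [|t] := @MVT_segment R g _ 0 1 ler01 (fun t _ => dg t).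
    apply: derivable_within_continuous => t _.
    exact: (@ex_derive _ _ _ _ _ _ _ (dg t)).
  rewrite in_itv /= => t01.
  rewrite subr0 mulr1 /g !expr0n /= !expr1n => gE.
  have := dphi_le t t01; rewrite ler_norml => /andP[h1 h2].
  by move/eqP: s2; rewrite sqrf_eq1 => /orP[] /eqP s1; rewrite s1 in gE *; lra.
by have h1 := key 1 ltac:(ring); have h2 := key (-1) ltac:(ring); rewrite ler_norml; lra.
Qed.

Lemma increment_le {R : realType} (phi dphi : R -> R) (p0 p1 a c : R) (n : nat) :
    (forall t, is_derive t (1 : R) phi (dphi t)) -> phi 0 = p0 -> phi 1 = p1 ->
    (forall t, 0 <= t <= 1 -> `|dphi t - a| <= c * (n.+1%:R * t ^+ n)) ->
  `|p1 - p0 - a| <= c.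
Proof.
move=> dphiE <- <- dphi_le; have := taylor_increment_le phi dphi a 0 c n dphiE.
by rewrite mulr0 addr0; apply => t t01; rewrite mulr0 addr0 dphi_le.
Qed.

Section LineDerivatives.
Context {R : realType} {d : nat}.
Implicit Types (F f : 'cV[R]_d -> R) (x h w : 'cV[R]_d).

Lemma is_derive_line F x h (t : R) :
  differentiable F (x + t *: h) ->
  is_derive t (1 : R) (fun s : R => F (x + s *: h)) (\sum_j partial j F (x + t *: h) * h j 0).
Proof.
move=> Fd; set y := x + t *: h.
have E : (fun s : R => s^-1 *: (F (x + (s *: (1 : R) + t) *: h) - F (x + t *: h)))
       = (fun s : R => s^-1 *: (F (s *: h + y) - F y)).
  apply/funext => s; rewrite /y; congr (_ *: (F _ - _)).
  by rewrite scalerDl /GRing.scale /= mulr1 addrCA.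
apply: DeriveDef.
  have := @diff_derivable _ _ _ F y h Fd.
  by rewrite /derivable -E.
transitivity ('D_h F y); first by rewrite /derive -E.
rewrite deriveE// {1}(matrix_sum_delta h) linear_sum; apply: eq_bigr => i _.
by rewrite big_ord1 linearZ /= -deriveE// mulrC.
Qed.

Variable f : 'cV[R]_d -> R.
Hypothesis f_C2 : twice_continuously_differentiable f.

Lemma is_derive_f_line x h (t : R) :
  is_derive t (1 : R) (fun s : R => f (x + s *: h)) (dotv (gradient f (x + t *: h)) h).
Proof.
have [fd _ _] := f_C2; have := is_derive_line f x h t (fd _).
suff -> : dotv (gradient f (x + t *: h)) h =
  \sum_j partial j f (x + t *: h) * h j 0 by [].
by rewrite dotvE; apply: eq_bigr => j _; rewrite mxE.
Qed.

Lemma differentiable_partial i x : differentiable (partial i f) x.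
Proof.
have [_ gd _] := f_C2.
have -> : partial i f = (fun N : 'cV[R]_d => N i 0 : R) \o gradient f.
  by apply/funext => y /=; rewrite mxE.
apply: differentiable_comp => //; exact: differentiable_coord.
Qed.

Lemma is_derive_gradient_line x h w (t : R) :
  is_derive t (1 : R) (fun s : R => dotv (gradient f (x + s *: h)) w)
    (dotv (hessian f (x + t *: h) *m h) w).
Proof.
have -> : (fun s : R => dotv (gradient f (x + s *: h)) w)
   = \sum_(i < d) (fun s : R => w i 0 * partial i f (x + s *: h)).
  apply/funext => s; rewrite fct_sumE dotvE; apply: eq_bigr => i _.
  by rewrite mxE mulrC.
have -> : dotv (hessian f (x + t *: h) *m h) w =
   \sum_(i < d) w i 0 * (\sum_j partial j (partial i f) (x + t *: h) * h j 0).
  rewrite dotvE; apply: eq_bigr => i _; rewrite mxE mulrC; congr (_ * _).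
  by apply: eq_bigr => j _; rewrite mxE.
apply: is_derive_sum => i.
apply: is_deriveZ; apply: is_derive_line; exact: differentiable_partial.
Qed.

End LineDerivatives.

(** Stands in for the limit e -> 0. If [a > 0], the choice e = a / (K + a + 1) makes [e * K] smaller
    than [a]. *)
Lemma le0_of_small {R : realFieldType} (a K : R) :
  0 <= K -> (forall e, 0 < e <= 1 -> a <= e * K) -> a <= 0.
Proof.
move=> K0 aK; rewrite leNgt; apply/negP => a0.
have c0 : 0 < K + a + 1 by lra.
have := aK (a / (K + a + 1)).
rewrite divr_gt0//= ler_pdivrMr// mul1r => /(_ ltac:(lra)).
rewrite mulrAC ler_pdivlMr//; nra.
Qed.

Section Taylor.
Context {R : realType} {d : nat} {B : 'M[R]_d} {f : 'cV[R]_d -> R} {L : R}.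
Hypothesis B_spd : sym_posdef B.
Hypothesis f_C2 : twice_continuously_differentiable f.
Hypothesis f_lip : hessian_lipschitz B f L.
Implicit Types (x y u v w h : 'cV[R]_d).
Local Notation "`| x |_B" := (primal_norm B x) (format "`| x |_B").

Lemma hessian_form_lip x y u v :
  `|dotv (hessian f y *m u) v - dotv (hessian f x *m u) v|
    <= L * `|y - x|_B * `|u|_B * `|v|_B.
Proof.
rewrite -dotvNl -dotvDl -mulmxBl.
rewrite (le_trans (dotv_mulmx_le B_spd _ _ _))//.
by rewrite !ler_wpM2r ?primal_norm_ge0.
Qed.

Lemma gradient_taylor x h w :
  `|dotv (gradient f (x + h)) w - dotv (gradient f x) w - dotv (hessian f x *m h) w|
    <= L / 2 * `|h|_B ^+ 2 * `|w|_B.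
Proof.
(* Here [n = 1]: the Lipschitz error L t |h|^2 |w| is (L/2) |h|^2 |w| times 2 t. *)
apply: (increment_le _ _ _ _ _ _ 1 (is_derive_gradient_line f f_C2 x h w)).
- by rewrite scale0r addr0.
- by rewrite scale1r.
move=> t /andP[t0 t1].
rewrite (le_trans (hessian_form_lip _ _ _ _))// addrAC subrr add0r primal_normZ ger0_norm// expr1.
lra.
Qed.

Lemma second_order_taylor x h :
  `|f (x + h) - f x - (dotv (gradient f x) h + 2^-1 * dotv (hessian f x *m h) h)|
    <= L / 6 * `|h|_B ^+ 3.
Proof.
have := taylor_increment_le _ _ (dotv (gradient f x) h) (dotv (hessian f x *m h) h)
  (L / 6 * `|h|_B ^+ 3) 2 (is_derive_f_line f f_C2 x h).
rewrite scale1r scale0r addr0; apply => t /andP[t0 t1].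
have := gradient_taylor x (t *: h) h.
rewrite primal_normZ (ger0_norm t0) -scalemxAr dotvZl opprD addrA => /le_trans; apply.
lra.
Qed.

(** The derivative in t of f(x + u + t v) - f(x + t v) is a gradient increment along [u]. It is
    compared with the Hessian at x + t v, and that Hessian with the one at [x]. *)
Lemma second_difference_bound x u v :
  `|f (x + u + v) - f (x + v) - (f (x + u) - f x) - dotv (hessian f x *m u) v|
    <= L / 2 * `|u|_B ^+ 2 * `|v|_B + L * `|v|_B ^+ 2 * `|u|_B.
Proof.
apply: (increment_le _ _ _ _ _ _ 0 (fun t =>
  is_deriveB (is_derive_f_line f f_C2 (x + u) v t) (is_derive_f_line f f_C2 x v t))).
- by rewrite !fctE scale0r !addr0.
- by rewrite !fctE scale1r.
move=> t /andP[t0 t1]; rewrite expr0 !mulr1.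
rewrite -(subrK (dotv (hessian f (x + t *: v) *m u) v)
  (_ - dotv (gradient f (x + t *: v)) v)) -addrA.
rewrite (le_trans (ler_normD _ _))// lerD//.
  by rewrite [x + u + _]addrAC gradient_taylor.
rewrite (le_trans (hessian_form_lip _ _ _ _))// addrAC subrr add0r primal_normZ ger0_norm//.
have : 0 <= L * `|v|_B * `|u|_B * `|v|_B.
  have := le_trans (normr_ge0 _) (hessian_form_lip x (x + v) u v).
  by rewrite [x + v - x]addrAC subrr add0r.
nra.
Qed.

(* Schwarz's theorem: both orders of differentiation approximate the same
   second difference up to a third-order error. *)
Lemma hessian_form_sym x u v :
  dotv (hessian f x *m u) v = dotv (hessian f x *m v) u.
Proof.
set nu := `|u|_B; set nv := `|v|_B.
(* At scale e the two second-difference errors add up to e^3 times this, with [L] in place of its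
   absolute value; dividing by e^2 leaves e K. *)
pose K := `|L| * (3 / 2 * (nu ^+ 2 * nv + nv ^+ 2 * nu)).
have nu0 : 0 <= nu := primal_norm_ge0 u.
have nv0 : 0 <= nv := primal_norm_ge0 v.
have K0 : 0 <= K.
  by rewrite mulr_ge0// mulr_ge0// addr_ge0// mulr_ge0// exprn_ge0.
apply/eqP; rewrite -subr_eq0 -normr_le0; apply: (le0_of_small _ K K0) => e /andP[e0 _].
have e2 := exprn_gt0 2 e0.
rewrite -(ler_pM2l e2) -[X in X * _](gtr0_norm e2) -normrM.
have := second_difference_bound x (e *: u) (e *: v).
have := second_difference_bound x (e *: v) (e *: u).
rewrite [x + e *: v + _]addrAC -!scalemxAr !dotv_lin !primal_normZ !(gtr0_norm e0) -/nu -/nv.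
have LL : L * (3 / 2 * (nu ^+ 2 * nv + nv ^+ 2 * nu)) <= K.
  by rewrite ler_wpM2r ?ler_norm// mulr_ge0// addr_ge0// mulr_ge0// exprn_ge0.
have := ler_wpM2l (ltW (exprn_gt0 3 e0)) LL.
rewrite !ler_norml => h1 /andP[h2 h3] /andP[h4 h5].
apply/andP; split; lra.
Qed.

End Taylor.

(** * Optimality conditions for the cubic model *)

Section CubicMinimizer.
Context {R : realType} {d : nat} {B H : 'M[R]_d} {g h : 'cV[R]_d} {M : R}.
Hypothesis B_spd : sym_posdef B.
Hypothesis M_ge0 : 0 <= M.
Implicit Types (u v w : 'cV[R]_d).
Local Notation "`| x |_B" := (primal_norm B x) (format "`| x |_B").
Hypothesis H_sym : forall u v, dotv (H *m u) v = dotv (H *m v) u.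

Let m v := dotv g v + 2^-1 * dotv (H *m v) v + M / 6 * `|v|_B ^+ 3.
Hypothesis h_min : forall v, m h <= m v.

Let r := `|h|_B.
Let slope v := dotv g v + dotv (H *m h) v + M / 2 * r * dotv (B *m h) v.
(** The rank-one part of the second derivative of the cubic term is left out, so nonnegativity is
    stronger than the local second-order condition and relies on global minimality. *)
Let curv v := dotv (H *m v) v + M / 2 * r * `|v|_B ^+ 2.

Lemma primal_norm_sqD u v :
  `|u + v|_B ^+ 2 = `|u|_B ^+ 2 + 2 * dotv (B *m u) v + `|v|_B ^+ 2.
Proof.
rewrite !primal_norm_sq// !dotv_lin (dotv_sym B v u B_spd.1); ring.
Qed.

(* [p^3 - r^3 = 3/2 r (p^2 - r^2) + (p - r)^2 (p + r/2)] isolates the part of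
   the cubic term which is a quadratic function of [v]. *)
Lemma cubic_increment_ge0 v :
  0 <= slope v + 2^-1 * curv v
         + M / 6 * ((`|h + v|_B - r) ^+ 2 * (`|h + v|_B + r / 2)).
Proof.
set p := `|h + v|_B; have := h_min (h + v); rewrite /m -/p -/r !dotv_lin (H_sym v h) /slope /curv.
have /esym pE : p ^+ 2 = _ := primal_norm_sqD h v; rewrite -/r in pE.
have -> : p ^+ 3 = r ^+ 3 + 3 / 2 * r * (p ^+ 2 - r ^+ 2) + (p - r) ^+ 2 * (p + r / 2).
  by field.
rewrite -pE; lra.
Qed.

Lemma dist_primal_normD v : `| `|h + v|_B - r | <= `|v|_B.
Proof.
by rewrite (le_trans (ler_dist_primal_norm B_spd _ _))// addrAC subrr add0r.
Qed.

(** Along [e *: u] the slope is of order e and the rest of order e^2, so the slope cannot be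
    negative; being odd, it vanishes. *)
Lemma cubic_step_stationary v : slope v = 0.
Proof.
have slope_ge0 u : - slope u <= 0.
  (* The second summand bounds the cubic remainder divided by e^2, since |p - r| <= e n and e <=
     1. *)
  pose n := `|u|_B; pose K := 2^-1 * `|curv u| + M / 6 * (n ^+ 2 * (n + 3 / 2 * r)).
  have n0 : 0 <= n := primal_norm_ge0 u.
  have r0 : 0 <= r := primal_norm_ge0 h.
  have M6 : 0 <= M / 6 by rewrite divr_ge0.
  have K0 : 0 <= K.
    rewrite addr_ge0 ?(mulr_ge0 _ (normr_ge0 _)) ?invr_ge0//.
    by rewrite mulr_ge0// mulr_ge0 ?exprn_ge0//; lra.
  apply: (le0_of_small _ K K0) => e /andP[e0 e1].
  have := cubic_increment_ge0 (e *: u).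
  have := dist_primal_normD (e *: u).
  rewrite primal_normZ (gtr0_norm e0) -/n ler_norml => /andP[p1 p2] /=.
  set p := `|_|_B in p1 p2 *.
  have -> : slope (e *: u) = e * slope u by rewrite /slope !dotv_lin; ring.
  have -> : curv (e *: u) = e ^+ 2 * curv u.
    by rewrite /curv primal_normZ (gtr0_norm e0) -!scalemxAr !dotv_lin; ring.
  have p0 : 0 <= p := primal_norm_ge0 _.
  have q : (p - r) ^+ 2 * (p + r / 2) <= e ^+ 2 * (n ^+ 2 * (n + 3 / 2 * r)).
    have -> : e ^+ 2 * (n ^+ 2 * (n + 3 / 2 * r)) = (e * n) ^+ 2 * (n + 3 / 2 * r) by ring.
    have en : e * n <= n by rewrite ler_piMl.
    apply: ler_pM; [exact: sqr_ge0| |nra|lra].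
    by lra.
  have := ler_wpM2l (ltW (exprn_gt0 2 e0)) (ler_norm (curv u)).
  move: (ler_wpM2l M6 q) => q' c' inc.
  rewrite -(ler_pM2l e0) /K; lra.
apply/eqP; rewrite eq_le -[X in _ && X]oppr_le0 slope_ge0 andbT.
have := slope_ge0 (- v); suff -> : slope (- v) = - slope v by rewrite opprK.
by rewrite /slope !dotv_lin; ring.
Qed.

(* For [v] not [B]-orthogonal to [h], reflecting [h] along [v] preserves the
   norm, so the remainder in [cubic_increment_ge0] vanishes; for orthogonal
   [v] it is of third order. *)
Lemma cubic_step_curvature v : 0 <= curv v.
Proof.
set n := `|v|_B; set b := dotv (B *m h) v.
have curvZ t : curv (t *: v) = t ^+ 2 * curv v.
  rewrite /curv primal_normZ exprMn -normrX ger0_norm ?sqr_ge0//.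
  by rewrite -!scalemxAr !dotv_lin; ring.
have r0 : 0 <= r := primal_norm_ge0 h.
have n0 : 0 <= n := primal_norm_ge0 v.
have [b0|b0] := eqVneq b 0; last first.
  have n_neq0 : n != 0.
    apply: contraNneq b0 => nz; rewrite /b (primal_norm_eq0 B_spd v nz).
    by rewrite dotvC dotv0l.
  (* The nonzero root of 2 t b + t^2 n^2 = 0, that is, of |h + t v| = r. *)
  pose t := - 2 * b / n ^+ 2.
  have t2 : 0 < t ^+ 2.
    rewrite exprn_even_gt0//= /t mulf_neq0// ?invr_eq0 ?expf_neq0//.
    by rewrite mulf_neq0// oppr_eq0 pnatr_eq0.
  have := cubic_increment_ge0 (t *: v).
  have -> : `|h + t *: v|_B = r.
    apply/eqP; rewrite -(@eqrXn2 _ 2)// ?primal_norm_ge0//; apply/eqP.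
    rewrite primal_norm_sqD !dotv_lin -/b -/r primal_normZ exprMn -normrX ger0_norm ?sqr_ge0// -/n.
    by rewrite /t; field.
  rewrite cubic_step_stationary curvZ subrr expr0n /= mul0r mulr0 addr0 add0r.
  by rewrite !pmulr_rge0// invr_gt0.
(* The remainder is at most (M/6) (e n)^3, because (p - r) (p + r) = (e n)^2 and p - r <= e n; the
   factor 1/2 before [curv] doubles it. *)
rewrite -oppr_le0; pose K := M / 3 * n ^+ 3.
have K0 : 0 <= K by rewrite mulr_ge0 ?exprn_ge0// divr_ge0.
apply: (le0_of_small _ K K0) => e /andP[e0 _].
have := cubic_increment_ge0 (e *: v).
rewrite cubic_step_stationary curvZ /=; set p := `|_|_B.
have p0 : 0 <= p := primal_norm_ge0 _.
have pE : p ^+ 2 = r ^+ 2 + (e * n) ^+ 2.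
  by rewrite /p primal_norm_sqD !dotv_lin -/b b0 primal_normZ (gtr0_norm e0) -/n -/r; ring.
have := mulr_ge0 (ltW e0) n0; set a := e * n in pE * => a0.
have pr : r <= p by rewrite -(@ler_pXn2r _ 2)// ?nnegrE// pE lerDl sqr_ge0.
have pra : p <= r + a.
  by rewrite -(@ler_pXn2r _ 2)// ?nnegrE ?addr_ge0// pE; nra.
have q : (p - r) ^+ 2 * (p + r / 2) <= a ^+ 3.
  have q1 : (p - r) ^+ 2 * (p + r / 2) <= (p - r) ^+ 2 * (p + r).
    by rewrite ler_wpM2l ?sqr_ge0//; lra.
  have q2 : (p - r) ^+ 2 * (p + r) = (p - r) * a ^+ 2.
    have -> : a ^+ 2 = p ^+ 2 - r ^+ 2 by rewrite pE; ring.
    by ring.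
  rewrite (le_trans q1)// q2 exprS ler_wpM2r ?sqr_ge0//; lra.
have M6 : 0 <= M / 6 by rewrite divr_ge0.
have := ler_wpM2l M6 q => q' inc.
rewrite -(ler_pM2l (exprn_gt0 2 e0)).
have -> : e ^+ 2 * (e * K) = 2 * (M / 6 * a ^+ 3) by rewrite /K /a; field.
lra.
Qed.

End CubicMinimizer.

(** * Bounds for one lazy step *)

Section Xi.
Context {R : realType} {d : nat} {B : 'M[R]_d}.
Hypothesis B_spd : sym_posdef B.

(* No square root of [invmx B] needs to be constructed: if there were none,
   [sqrt_mx] would be 0 and so would [xi]. *)
Lemma xi_le (f : 'cV[R]_d -> R) (x : 'cV[R]_d) (c : R) : 0 <= c ->
  (forall v, - c * primal_norm B v ^+ 2 <= dotv (hessian f x *m v) v) ->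
  xi B f x <= c.
Proof.
move=> c0; rewrite /xi; move: (hessian f x) => H Hc.
rewrite ge_max c0 andbT lerNl /lambda_min.
set S := sqrt_mx _; set E := (X in inf X).
(* Without eigenvalues the infimum takes its default 0, which is still at least [- c]. *)
suff lbE : lbound E (- c).
  have [E0|/set0P ne] := eqVneq E set0; first by rewrite E0 inf0 oppr_le0.
  exact: lb_le_inf.
move=> a /= /eigenvalueP[v vA v0].
have vv : 0 < dotv v^T v^T.
  have : dotv v^T v^T != 0.
    apply: contra_neq v0 => vv0; apply/trmx_inj; rewrite trmx0.
    apply/matrixP => i j; rewrite ord1 [RHS]mxE; apply/eqP.
    move/eqP: vv0; rewrite dotvE psumr_eq0; last by move=> k _; rewrite -expr2 sqr_ge0.
    by move/allP/(_ i (mem_index_enum i)); rewrite mulf_eq0 orbb.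
  rewrite lt_def => ->; rewrite dotvE sumr_ge0// => k _; by rewrite -expr2 sqr_ge0.
(* [eigenvalue] speaks of row vectors, hence the transposes. *)
have form : dotv (S *m H *m S *m v^T) v^T = a * dotv v^T v^T.
  by rewrite dotv_mulmx -trmx_mul vA linearZ dotvZr.
rewrite -(ler_pM2r vv) -form {form}; move: (erefl S); rewrite {2}/S /sqrt_mx.
case: xgetP => [S' _ [S_spd SS] ->|_ ->]; last first.
  by rewrite mulmx0 mul0mx dotv0l mulNr oppr_le0 mulr_ge0// ltW.
have S_unit := spd_unitmx S_spd; have B_unit := spd_unitmx B_spd.
(* This makes the [B]-norm of [S' *m v^T] the Euclidean norm of [v], so [Hc] at that vector bounds
   the eigenvalue. *)
have SBS : S' *m B *m S' = 1%:M.
  rewrite -[LHS]mulmx1 -(mulmxV S_unit) !mulmxA -(mulmxA _ S' S') SS.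
  by rewrite -(mulmxA S' B) (mulmxV B_unit) mulmx1.
have dotv_tr u w : dotv (S' *m u) w = dotv u (S' *m w).
  by rewrite dotv_mulmx S_spd.1.
have := Hc (S' *m v^T).
have -> : primal_norm B (S' *m v^T) ^+ 2 = dotv v^T v^T.
  by rewrite primal_norm_sq// -dotv_tr !mulmxA SBS mul1mx.
by rewrite -dotv_tr !mulmxA.
Qed.

End Xi.

Section LazyStep.
Context {R : realType} {d : nat} {B : 'M[R]_d} {f : 'cV[R]_d -> R} {L M : R}.
Context {x z T : 'cV[R]_d}.
Hypothesis B_spd : sym_posdef B.
Hypothesis f_C2 : twice_continuously_differentiable f.
Hypothesis L_gt0 : 0 < L.
Hypothesis f_lip : hessian_lipschitz B f L.
Hypothesis M_ge0 : 0 <= M.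
Hypothesis T_step : is_lazy_cubic_step B f M x z T.
Local Notation "`| x |_B" := (primal_norm B x) (format "`| x |_B").
Local Notation h := (T - x).
Local Notation r := (`|T - x|_B).
Local Notation s := (`|z - x|_B).

Lemma lazy_cubic_step_min v :
  dotv (gradient f x) h + 2^-1 * dotv (hessian f z *m h) h + M / 6 * `|h|_B ^+ 3
  <= dotv (gradient f x) v + 2^-1 * dotv (hessian f z *m v) v + M / 6 * `|v|_B ^+ 3.
Proof.
have E : x + v - x = v by rewrite addrAC subrr add0r.
by have := T_step (x + v); rewrite /lazy_cubic_model E.
Qed.

Let stationary := cubic_step_stationary B_spd M_ge0
  (hessian_form_sym B_spd f_C2 f_lip z) lazy_cubic_step_min.
Let curvature := cubic_step_curvature B_spd M_ge0
  (hessian_form_sym B_spd f_C2 f_lip z) lazy_cubic_step_min.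

Lemma hessian_drift u v :
  `|dotv (hessian f x *m u) v - dotv (hessian f z *m u) v|
    <= L * s * `|u|_B * `|v|_B.
Proof.
have := hessian_form_lip B_spd f_lip z x u v.
by rewrite -[`|x - z|_B]primal_normN opprB.
Qed.

(** Stationarity along [h] eliminates the gradient from the Taylor expansion, leaving M r^3 / 2 plus
    half the form of the Hessian at [z]; curvature bounds that half below by - M r^3 / 4. *)
Lemma lazy_step_decrease :
  (M / 4 - L / 6) * r ^+ 3 - L / 2 * s * r ^+ 2 <= f x - f T.
Proof.
have arith (ft fx a b c r s : R) :
    `|ft - fx - (a + 2^-1 * b)| <= L / 6 * r ^+ 3 ->
    a + c + M / 2 * r * r ^+ 2 = 0 -> 0 <= c + M / 2 * r * r ^+ 2 ->
    `|b - c| <= L * s * r * r ->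
    (M / 4 - L / 6) * r ^+ 3 - L / 2 * s * r ^+ 2 <= fx - ft.
  by rewrite !ler_norml => /andP[_ ?] ? ? /andP[_ ?]; lra.
have taylor := second_order_taylor B_spd f_C2 f_lip x h.
have xh : x + h = T by rewrite addrC subrK.
rewrite xh in taylor.
apply: arith taylor _ (curvature h) (hessian_drift h h).
by rewrite (primal_norm_sq B_spd h); exact: stationary.
Qed.

Lemma lazy_step_gradient :
  dual_norm B (gradient f T) <= (L + M) / 2 * r ^+ 2 + L * s * r.
Proof.
have arith (gt gx b c e n r s : R) : 0 <= r ->
    `|gt - gx - b| <= L / 2 * r ^+ 2 * n -> gx + c + M / 2 * r * e = 0 ->
    `|b - c| <= L * s * r * n -> - e <= r * n ->
    gt <= ((L + M) / 2 * r ^+ 2 + L * s * r) * n.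
  move=> r0; rewrite !ler_norml => /andP[_ h1] h2 /andP[_ h3] h4.
  have : 0 <= M / 2 * r by rewrite mulr_ge0// divr_ge0.
  by move=> /ler_wpM2l /(_ _ _ h4); lra.
have r0 : 0 <= r := primal_norm_ge0 h.
have L0 := ltW L_gt0.
apply: dual_norm_le => //.
  by rewrite addr_ge0 ?mulr_ge0 ?primal_norm_ge0 ?exprn_ge0 ?addr_ge0 ?invr_ge0.
move=> w; have taylor := gradient_taylor B_spd f_C2 f_lip x h w.
have xh : x + h = T by rewrite addrC subrK.
rewrite xh in taylor.
apply: arith r0 taylor (stationary w) (hessian_drift h w) _.
by rewrite -dotvNr -(primal_normN w) cauchy_schwarz.
Qed.

(** Curvature is known for the Hessian at [z]; moving to [T] costs L |T - z| <= L (r + s). *)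
Lemma lazy_step_xi : xi B f T <= M / 2 * r + L * (r + s).
Proof.
have arith (q q' n r s t : R) : 0 <= n -> t <= r + s ->
    0 <= q + M / 2 * r * n ^+ 2 -> `|q' - q| <= L * t * n * n ->
    - (M / 2 * r + L * (r + s)) * n ^+ 2 <= q'.
  move=> n0 trs h1; rewrite ler_norml => /andP[h2 _].
  have : 0 <= L * n ^+ 2 by rewrite mulr_ge0 ?exprn_ge0// ltW.
  by move=> /ler_wpM2l /(_ _ _ trs); lra.
have r0 : 0 <= r := primal_norm_ge0 h.
have s0 : 0 <= s := primal_norm_ge0 (z - x).
apply: xi_le => //.
  by rewrite addr_ge0// mulr_ge0 ?addr_ge0 ?divr_ge0// ltW.
move=> v; apply: arith (primal_norm_ge0 v) _ (curvature v)
  (hessian_form_lip B_spd f_lip z T v v).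
rewrite -[s]primal_normN opprB.
by rewrite (le_trans _ (ler_primal_normD B_spd _ _))// addrA subrK.
Qed.

End LazyStep.

(** * Scalar inequalities and conclusion *)

Lemma xi_term_le {R : realFieldType} (L M r s q : R) :
    0 < L -> L <= M -> 0 <= r -> 0 <= s -> 0 <= q ->
    q <= M / 2 * r + L * (r + s) ->
  (648 * M ^+ 2)^-1 * q ^+ 3 + M / 48 * r ^+ 3 - 11 * L ^+ 3 / M ^+ 2 * s ^+ 3
  <= (M / 4 - L / 6) * r ^+ 3 - L / 2 * s * r ^+ 2.
Proof.
move=> L0 LM r0 s0 q0 qle; have M0 : 0 < M by lra.
have L0w := ltW L0; have M0w := ltW M0.
(* With this [t], after [L] is replaced by [M] where allowed, every term is [M] times a cubic form
   in [r] and [t]. *)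
have [t tE] : exists t, t = L * s / M by eexists.
have t0 : 0 <= t by rewrite tE divr_ge0 ?mulr_ge0.
have Mn0 : M != 0 by rewrite gt_eqF.
have LsE : L * s = M * t by rewrite tE; field.
have -> : 11 * L ^+ 3 / M ^+ 2 * s ^+ 3 = M * (11 * t ^+ 3).
  by rewrite tE; field.
have q3 : (648 * M ^+ 2)^-1 * q ^+ 3 <= M * ((3 / 2 * r + t) ^+ 3 / 648).
  have h3 : q ^+ 3 <= (M * (3 / 2 * r + t)) ^+ 3.
    rewrite ler_pXn2r ?nnegrE//; last by rewrite mulr_ge0//; lra.
    have : L * r <= M * r by rewrite ler_wpM2r.
    by rewrite mulrDr in qle; lra.
  have M2 : 0 < M ^+ 2 by rewrite exprn_gt0.
  rewrite mulrC ler_pdivrMr; last by lra.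
  apply: (le_trans h3).
  by rewrite le_eqVlt; apply/orP; left; apply/eqP; field.
have Lr : L / 6 * r ^+ 3 <= M / 6 * r ^+ 3.
  by rewrite ler_wpM2r ?exprn_ge0//; lra.
have P : (3 / 2 * r + t) ^+ 3 / 648 + r ^+ 3 / 48 - 11 * t ^+ 3
    <= r ^+ 3 / 12 - t * r ^+ 2 / 2.
  (* The difference of the two sides, a cubic form in (r, t), dominates
     (r - 6 t)^2 (a r + b t) for some a, b > 0. *)
  have := mulr_ge0 (sqr_ge0 (r - 6 * t)) r0.
  have := mulr_ge0 (sqr_ge0 (r - 6 * t)) t0.
  have := mulr_ge0 (sqr_ge0 r) t0; have := mulr_ge0 r0 (sqr_ge0 t).
  by have := exprn_ge0 3 t0; lra.
have -> : L / 2 * s * r ^+ 2 = M * (t * r ^+ 2 / 2).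
  by rewrite (_ : L / 2 * s = L * s / 2); [rewrite LsE|]; ring.
have := ler_wpM2l (ltW M0) P; lra.
Qed.

Lemma gradient_term_le {R : realType} (L M r s q : R) :
    0 < L -> L <= M -> 0 <= r -> 0 <= s -> 0 <= q ->
    q <= (L + M) / 2 * r ^+ 2 + L * s * r ->
  (72 * Num.sqrt (2 * M))^-1 * q `^ (3 / 2) + M / 48 * r ^+ 3
    - 11 * L ^+ 3 / M ^+ 2 * s ^+ 3
  <= (M / 4 - L / 6) * r ^+ 3 - L / 2 * s * r ^+ 2.
Proof.
move=> L0 LM r0 s0 q0 qle; have M0 : 0 < M by lra.
have L0w := ltW L0; have M0w := ltW M0.
have [t tE] : exists t, t = L * s / M by eexists.
have t0 : 0 <= t by rewrite tE divr_ge0 ?mulr_ge0.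
have Mn0 : M != 0 by rewrite gt_eqF.
have LsE : L * s = M * t by rewrite tE; field.
have -> : 11 * L ^+ 3 / M ^+ 2 * s ^+ 3 = M * (11 * t ^+ 3).
  by rewrite tE; field.
have m0 : 0 < Num.sqrt M by rewrite sqrtr_gt0.
have mm : Num.sqrt M ^+ 2 = M by rewrite sqr_sqrtr ?ltW.
have a0 : 0 <= r + t / 2 by lra.
(* Completing the square: q <= M (r^2 + t r) <= M (r + t/2)^2. *)
have q32 : q `^ (3 / 2) <= (Num.sqrt M * (r + t / 2)) ^+ 3.
  set a := Num.sqrt M * _.
  have apos : 0 <= a by rewrite mulr_ge0 ?sqrtr_ge0.
  have -> : a ^+ 3 = (a ^+ 2) `^ (3 / 2).
    by rewrite -!powR_mulrn// -powRrM; congr (_ `^ _); field.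
  rewrite ge0_ler_powR ?nnegrE ?exprn_ge0//.
  rewrite /a exprMn mm (le_trans qle)// LsE.
  have : L * r ^+ 2 <= M * r ^+ 2 by rewrite ler_wpM2r ?exprn_ge0.
  have : 0 <= M * t ^+ 2 by rewrite mulr_ge0 ?exprn_ge0.
  by lra.
have q3 : (72 * Num.sqrt (2 * M))^-1 * q `^ (3 / 2) <= M * ((r + t / 2) ^+ 3 / 72).
  have sM : Num.sqrt M <= Num.sqrt (2 * M) by rewrite ler_wsqrtr//; lra.
  have sM0 : 0 < 72 * Num.sqrt (2 * M) by lra.
  rewrite mulrC ler_pdivrMr//; apply: (le_trans q32).
  rewrite exprMn exprSr mm.
  have c0 : 0 <= M * (r + t / 2) ^+ 3 by rewrite mulr_ge0 ?exprn_ge0// ltW.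
  by have := ler_wpM2l c0 sM; lra.
have Lr : L / 6 * r ^+ 3 <= M / 6 * r ^+ 3.
  by rewrite ler_wpM2r ?exprn_ge0//; lra.
have P : (r + t / 2) ^+ 3 / 72 + r ^+ 3 / 48 - 11 * t ^+ 3
    <= r ^+ 3 / 12 - t * r ^+ 2 / 2.
  (* The difference of the two sides, a cubic form in (r, t), dominates
     (r - 36/5 t)^2 (a r + b t) for some a, b > 0. *)
  have := mulr_ge0 (sqr_ge0 (r - 36 / 5 * t)) r0.
  have := mulr_ge0 (sqr_ge0 (r - 36 / 5 * t)) t0.
  have := mulr_ge0 (sqr_ge0 r) t0; have := mulr_ge0 r0 (sqr_ge0 t).
  by have := exprn_ge0 3 t0; lra.
have -> : L / 2 * s * r ^+ 2 = M * (t * r ^+ 2 / 2).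
  by rewrite (_ : L / 2 * s = L * s / 2); [rewrite LsE|]; ring.
have := ler_wpM2l (ltW M0) P; lra.
Qed.

Theorem theorem2p1 (R : realType) (d : nat) (B : 'M[R]_d)
    (f : 'cV[R]_d -> R) (L M : R) (x z T : 'cV[R]_d)
    (B_spd : sym_posdef B)
    (f_C2 : twice_continuously_differentiable f)
    (L_gt0 : 0 < L)
    (f_lip : hessian_lipschitz B f L)
    (LM : L <= M)
    (T_step : is_lazy_cubic_step B f M x z T) :
  f x - f T >=
    Num.max ((648 * M ^+ 2)^-1 * xi B f T ^+ 3)
            ((72 * Num.sqrt (2 * M))^-1 *
               (dual_norm B (gradient f T) `^ (3 / 2)))
    + M / 48 * primal_norm B (T - x) ^+ 3
    - 11 * L ^+ 3 / M ^+ 2 * primal_norm B (z - x) ^+ 3.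
Proof.
have M0 : 0 <= M by lra.
have decr := lazy_step_decrease B_spd f_C2 f_lip M0 T_step.
apply: le_trans decr.
(* Both entries of the maximum are compared with the same lower bound on the decrease, one scalar
   inequality each. *)
rewrite -addrA -lerBrDr ge_max; apply/andP; split; rewrite lerBrDr addrA.
- apply: xi_term_le => //; rewrite ?primal_norm_ge0//.
    by rewrite le_max lexx orbT.
  exact: lazy_step_xi.
- apply: gradient_term_le => //; rewrite ?primal_norm_ge0 ?dual_norm_ge0//.
  exact: lazy_step_gradient.
Qed.
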